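(* Let $G$ be a finite simple graph with $n$ vertices and clique number $\omega$. Then: (i) $\eta(G) \geq \frac{\omega}{n-\omega+1}$; (ii) if $G$ is regular and $\omega > \frac{n+4}{3}$, then $\eta(G) \geq 3$.
   Context: For a vertex $v$, $N(v)$ denotes its set of neighbours. An additive labeling of a graph $G$ is a function $\ell: V(G) \to \mathbb{N}$ (positive integers) such that for every two adjacent vertices $u,v$ of $G$, $\sum_{w \in N(v)} \ell(w) \neq \sum_{w \in N(u)} \ell(w)$. The additive number $\eta(G)$ is the minimum $k$ such that $G$ has an additive labeling $\ell: V(G) \to \{1,\dots,k\}$. The clique number $\omega$ is the maximum number of pairwise adjacent vertices of $G$. *)

(* Defs.v *)
From HB Require Import structures.
From mathcomp Require Import all_boot all_order all_algebra.

Set Implicit Arguments.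
Unset Strict Implicit.
Unset Printing Implicit Defensive.

Record sgraph := SGraph {
  vertex :> finType;
  edge : rel vertex;
  edge_sym : symmetric edge;
  edge_irrefl : irreflexive edge
}.

Definition neighbors (G : sgraph) (v : G) : {set G} := [set w | edge v w].

Definition regular (G : sgraph) : Prop :=
  exists d : nat, forall v : G, #|neighbors v| = d.

Definition clique (G : sgraph) (A : {set G}) : bool :=
  [forall u in A, forall v in A, (u != v) ==> edge u v].

Definition clique_number (G : sgraph) : nat :=
  \max_(A : {set G} | clique A) #|A|.

Definition nsum (G : sgraph) (l : G -> nat) (v : G) : nat :=
  \sum_(w in neighbors v) l w.

Definition additive_labeling (G : sgraph) (l : G -> nat) : bool :=
  [forall v, 0 < l v] && [forall u, forall v, edge u v ==> (nsum l u != nsum l v)].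

(* The value 0 of 'I_k.+1 is excluded by positivity, so the labels range over
   {1, ..., k}. *)
Definition has_additive_labeling (G : sgraph) (k : nat) : bool :=
  [exists l : {ffun G -> 'I_k.+1}, additive_labeling (fun v => l v : nat)].

Lemma has_additive_labelingP (G : sgraph) (k : nat) :
  reflect (exists2 l : G -> nat, additive_labeling l & forall v, l v <= k)
          (has_additive_labeling G k).
Proof.
apply: (iffP existsP) => [[l l_add]|[l /andP[/forallP l_gt0 /'forall_forallP l_ne] l_le]].
  by exists (fun v => l v : nat) => // v; rewrite -ltnS.
exists [ffun v => inord (l v)].
have lE v : nat_of_ord ([ffun v => inord (l v)] v : 'I_k.+1) = l v.
  by rewrite ffunE inordK // ltnS.
have sE v : nsum (fun v => ([ffun v => inord (l v)] v : 'I_k.+1) : nat) v = nsum l v.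
  by apply: eq_bigr => w _; rewrite lE.
apply/andP; split; first by apply/forallP => v; rewrite lE.
by apply/'forall_forallP => u v; rewrite !sE; apply: l_ne.
Qed.

Lemma sum_exp2_lt (I : finType) (r : I -> nat) (A : {set I}) (m : nat) :
  injective r -> (forall i, i \in A -> r i < m) -> \sum_(i in A) 2 ^ r i < 2 ^ m.
Proof.
move=> r_inj; elim: m A => [|m IHm] A lt_r.
  by rewrite big1 // => i /lt_r.
have [/existsP[i /andP[iA /eqP ri]]|/existsPn no_i] :=
    boolP [exists i, (i \in A) && (r i == m)].
  rewrite (big_setD1 i) //= ri expnS mul2n -addnn ltn_add2l.
  apply: IHm => j /setD1P[ne_ji /lt_r]; rewrite ltnS leq_eqVlt -ri.
  by rewrite (inj_eq r_inj) (negPf ne_ji).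
apply: leq_trans (IHm A _) _; last by rewrite leq_exp2l.
move=> j jA; move: (lt_r j jA) (no_i j).
by rewrite ltnS leq_eqVlt jA /= => /orP[->|].
Qed.

Lemma sum_exp2_inj (I : finType) (r : I -> nat) : injective r ->
  injective (fun A : {set I} => \sum_(i in A) 2 ^ r i).
Proof.
move=> r_inj.
have aux (A B : {set I}) i : \sum_(j in A) 2 ^ r j = \sum_(j in B) 2 ^ r j ->
    i \in A :\: B -> (forall j, j \in B :\: A -> r j <= r i) -> False.
  move=> eqAB iAB i_max.
  move: eqAB; rewrite (big_setID B) [X in _ = X](big_setID A) /= (setIC B A).
  move/addnI => eqD.
  have: \sum_(j in B :\: A) 2 ^ r j < 2 ^ r i.
    apply: sum_exp2_lt => // j jBA.
    rewrite ltn_neqAle (inj_eq r_inj) i_max // andbT.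
    by apply: contraTneq jBA => ->; case/setDP: iAB => iA _; rewrite inE iA.
  by rewrite -eqD (big_setD1 i) //= ltnNge leq_addr.
move=> A B /= eqAB; apply/eqP/negPn/negP => neAB.
have [i0 i0D] : exists i, i \in (A :\: B) :|: (B :\: A).
  apply/set0Pn; apply: contra neAB; rewrite setU_eq0 !setD_eq0 => /andP[sAB sBA].
  by rewrite eqEsubset sAB sBA.
case: (arg_maxnP r i0D) => i /setUP[] iD i_max.
  by apply: (aux A B i) => // j jD; apply: i_max; apply/setUP; right.
by apply: (aux B A i) => // j jD; apply: i_max; apply/setUP; left.
Qed.

(* Labeling by distinct powers of 2 makes the neighborhood sum determine the
   neighborhood, so it always yields an additive labeling. *)
Lemma additive_labeling_exists (G : sgraph) : exists k, has_additive_labeling G k.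
Proof.
pose l (v : G) := 2 ^ enum_rank v.
exists (\max_v l v); apply/has_additive_labelingP.
exists l; last by move=> v; apply: leq_bigmax.
apply/andP; split; first by apply/forallP => v; rewrite expn_gt0.
apply/'forall_forallP => u v; apply/implyP => uv; apply/eqP => eq_uv.
have r_inj : injective (fun w : G => nat_of_ord (enum_rank w)).
  by move=> x y /val_inj/enum_rank_inj.
have /setP/(_ v) := sum_exp2_inj r_inj eq_uv.
by rewrite !inE uv edge_irrefl.
Qed.

Definition additive_number (G : sgraph) : nat :=
  ex_minn (additive_labeling_exists G).

(* Main.v *)
Require Import Defs.
From HB Require Import structures.
From mathcomp Require Import all_boot all_order all_algebra.
From mathcomp Require Import zify lra.
Import Order.TTheory GRing.Theory Num.Theory.
Local Open Scope ring_scope.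

(** On a maximum clique [K], the neighborhood sum of [v] plus the label of [v]
    is the total label of [K] plus the contribution of the neighbors of [v]
    outside [K].  If these outer contributions lie in an interval
    [[lo, lo + r]] and the labels in [[1, k]], the sums on [K] take at most
    [r + k] values, and they are pairwise distinct, so [#|K| <= r + k].
    In general [lo = 0] and [r = k * (n - omega)] will do.  If [G] is regular
    and [k = 2], all vertices of [K] have the same number [t] of outer
    neighbors, so the outer contribution is both [t] plus the number of outer
    neighbors labelled 2 and [2 * t] minus the number of those not labelled 2;
    counting the rarer of the two kinds allows [2 * r <= n - omega]. *)

Lemma max_clique_exists (G : sgraph) :
  exists2 K : {set G}, clique K & #|K| = clique_number G.
Proof.
have cl0 : @clique G set0 by apply/forall_inP => u; rewrite inE.
have [K clK ->] : {K : {set G} | clique K & clique_number G = #|K|}.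
  by apply: eq_bigmax_cond; apply/card_gt0P; exists set0.
by exists K.
Qed.

Lemma additive_number_has_labeling (G : sgraph) :
  has_additive_labeling G (additive_number G).
Proof. by rewrite /additive_number; case: ex_minnP. Qed.

Lemma clique_neighborsI (G : sgraph) (K : {set G}) (v : G) :
  clique K -> v \in K -> neighbors v :&: K = K :\ v.
Proof.
move=> /forall_inP clK vK; apply/setP => w; rewrite !inE andbC.
case: eqVneq => [->|ne_wv] /=; first by rewrite edge_irrefl andbF.
case wK: (w \in K) => //=.
by move/forall_inP: (clK v vK) => /(_ w wK); rewrite eq_sym ne_wv.
Qed.

(** A vertex of [K] sees all of [K] except itself; adding [l v] supplies the missing term, so the
    part from [K] is independent of [v]. *)
Lemma nsum_clique (G : sgraph) (l : G -> nat) (K : {set G}) (v : G) :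
    clique K -> v \in K ->
  (nsum l v + l v =
     \sum_(w in K) l w + \sum_(w in neighbors v :\: K) l w)%N.
Proof.
move=> clK vK; rewrite /nsum (big_setID K) /= clique_neighborsI //.
by rewrite [in RHS](big_setD1 v) //= addnC addnA.
Qed.

Lemma card_le_inj_lt (T : finType) (A : {set T}) (f : T -> nat) (m : nat) :
  {in A &, injective f} -> {in A, forall x, f x < m}%N -> (#|A| <= m)%N.
Proof.
move=> f_inj f_lt; rewrite cardE -(size_map f) -(size_iota 0 m).
apply: uniq_leq_size => [|_ /mapP[x xA ->]].
  by rewrite map_inj_in_uniq ?enum_uniq // => x y; rewrite !mem_enum; apply: f_inj.
by rewrite mem_iota add0n f_lt // -mem_enum.
Qed.

Lemma card_clique_le (G : sgraph) (l : G -> nat) (K : {set G}) (k lo r : nat) :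
    clique K -> additive_labeling l -> (forall v, l v <= k)%N ->
    {in K, forall v,
       lo <= \sum_(w in neighbors v :\: K) l w <= lo + r}%N ->
  (#|K| <= r + k)%N.
Proof.
move=> clK /andP[/forallP l_gt0 /'forall_forallP l_ne] l_le e_bd.
pose L := (\sum_(w in K) l w)%N.
have sum_bd v : v \in K ->
    (L + lo <= nsum l v + k /\ nsum l v < L + lo + r)%N.
  move=> vK; have := nsum_clique G l K v clK vK; rewrite -/L.
  by have := e_bd v vK; have := l_gt0 v; have := l_le v; lia.
(* By [sum_bd] this subtraction never truncates, so the shift preserves distinctness. *)
apply: (card_le_inj_lt _ _ (fun v => nsum l v + k - (L + lo))%N).
  move=> u v uK vK /= eq_uv; apply/eqP/negPn/negP => ne_uv.
  have uv : edge u v.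
    by move/forall_inP: clK => /(_ u uK)/forall_inP/(_ v vK); rewrite ne_uv.
  have := implyP (l_ne u v) uv.
  by have [] := sum_bd u uK; have [] := sum_bd v vK; lia.
by move=> v vK /=; have [] := sum_bd v vK; lia.
Qed.

Lemma clique_number_le (G : sgraph) (k : nat) : has_additive_labeling G k ->
  (clique_number G <= k * (#|G| - clique_number G).+1)%N.
Proof.
move=> /has_additive_labelingP[l l_add l_le].
have [K clK <-] := max_clique_exists G.
rewrite mulnS addnC; apply: (card_clique_le G l K k 0) => // v vK /=.
rewrite add0n; apply: (@leq_trans (\sum_(w in neighbors v :\: K) k)%N).
  by apply: leq_sum.
rewrite sum_nat_const mulnC leq_mul2l -cardsT -cardsDS ?subsetT //.
by rewrite subset_leq_card ?orbT ?setSD ?subsetT.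
Qed.

Lemma regular_card_outer (G : sgraph) (K : {set G}) : regular G -> clique K ->
  exists t, {in K, forall v, #|neighbors v :\: K| = t}.
Proof.
move=> [d deg] clK; exists (d - #|K|.-1)%N => v vK.
by rewrite cardsD clique_neighborsI // deg (cardsD1 v K) vK.
Qed.

(** With [A] and [B] the vertices outside [K] labelled 2 and 1, add [#|K| <= #|A| + 2],
    [#|K| <= #|B| + 2] and [#|A| + #|B| + #|K| = #|G|]. *)
Lemma regular_clique_number_le (G : sgraph) (k : nat) :
    regular G -> has_additive_labeling G k -> (k <= 2)%N ->
  (3 * clique_number G <= #|G| + 4)%N.
Proof.
move=> reg /has_additive_labelingP[l l_add l_le] le_k2.
have l_le2 v : (l v <= 2)%N by apply: leq_trans (l_le v) le_k2.
have [K clK <-] := max_clique_exists G.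
have [t tE] := regular_card_outer G K reg clK.
pose A := [set w | l w == 2%N] :\: K; pose B := [set w | l w != 2%N] :\: K.
have cAB : (#|A| + #|B| + #|K| = #|G|)%N.
  have -> : A = ~: K :&: [set w | l w == 2%N].
    by apply/setP => w; rewrite !inE.
  have -> : B = ~: K :\: [set w | l w == 2%N].
    by apply/setP => w; rewrite !inE andbC.
  by rewrite cardsID addnC cardsC.
have l_gt0 : forall v, (0 < l v)%N by apply/forallP; case/andP: l_add.
pose e v := (\sum_(w in neighbors v :\: K) l w)%N.
have outer v : v \in K ->
    (t <= e v <= t + #|A|)%N /\ (e v <= 2 * t <= e v + #|B|)%N.
  move=> vK; pose D := neighbors v :\: K.
  (* Labels are 1 or 2, so each is 1 plus the indicator of being 2. *)
  have eA : (e v = t + #|D :&: [set w | l w == 2%N]|)%N.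
    rewrite -(tE v vK) -!sum1_card [X in (_ + X)%N](eq_bigl
      (fun w => (w \in D) && (l w == 2%N))); last by move=> w; rewrite !inE.
    rewrite big_mkcondr -big_split /=.
    apply: eq_bigr => w _.
    by have := l_gt0 w; have := l_le2 w; case: eqP; lia.
  have cD := cardsID [set w | l w == 2%N] D; rewrite tE // in cD.
  have leA : (#|D :&: [set w | l w == 2%N]| <= #|A|)%N.
    apply/subset_leq_card/subsetP => w; rewrite !inE.
    by case/andP => /andP[-> _] ->.
  have leB : (#|D :\: [set w | l w == 2%N]| <= #|B|)%N.
    apply/subset_leq_card/subsetP => w; rewrite !inE.
    by case/and3P => -> -> _.
  by lia.
have leA : (#|K| <= #|A| + 2)%N.
  apply: (card_clique_le G l K 2 t) => // v vK.
  by have := outer v vK; rewrite /e; lia.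
have leB : (#|K| <= #|B| + 2)%N.
  (* If [2 * t < #|B|], the lower end truncates to 0, and [e v <= 2 * t] still keeps [e v] within
     [#|B|] of it. *)
  apply: (card_clique_le G l K 2 (2 * t - #|B|)) => // v vK.
  by have := outer v vK; rewrite /e; lia.
by lia.
Qed.

Theorem theorem2 (G : sgraph) (n omega : nat)
    (hn : n = #|G|) (homega : omega = clique_number G) :
  (omega%:R / (n%:R - omega%:R + 1) <= (additive_number G)%:R :> rat) /\
  (regular G -> (n%:R + 4) / 3 < omega%:R :> rat -> (3 <= additive_number G)%N).
Proof.
have eta_lab := additive_number_has_labeling G.
split=> [|reg lt_omega].
  (* Makes the rational [n - omega] the cast of the natural one, so the denominator is a positive
     successor. *)
  have le_omega_n : (omega <= n)%N.
    by have [K _ cK] := max_clique_exists G; rewrite homega hn -cK max_card.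
  rewrite -natrB // natr1 ler_pdivrMr ?ltr0n // -natrM ler_nat homega hn.
  exact: clique_number_le.
rewrite leqNgt; apply/negP => le_eta.
have := regular_clique_number_le G _ reg eta_lab le_eta.
rewrite -homega -hn -(ler_nat rat) natrM natrD.
by move: lt_omega; rewrite ltr_pdivrMr //; lra.
Qed.
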